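(* Let $N$ be a positive integer and let $G$, $M$, $\pi$ be the hard instance described in the context. For any integer $d \ge 1$ and any $0 < p \le 1$, Algorithm FAP (described in the context) with parameters $d$ and $p$, run on the stream $\pi$ and the maximal matching $M$, returns with high probability a set $\mathcal{Q}$ of vertex-disjoint augmenting paths with \[|\mathcal{Q}| \le \left( \Big(\frac{1}{d+p} - \frac{1}{2d}\Big) \cdot p + o(1) \right) \mu(G). \]
   Context: $\mu(G)$ is the maximum matching size. Hard instance: vertex sets $A_{\text{in}}=\{a_{\text{in}}^1,\dots,a_{\text{in}}^N\}$, $A_{\text{out}}=\{a_{\text{out}}^1,\dots,a_{\text{out}}^N\}$, $B_{\text{in}}=\{b_{\text{in}}^1,\dots,b_{\text{in}}^N\}$, $B_{\text{out}}=\{b_{\text{out}}^1,\dots,b_{\text{out}}^N\}$; $M=\{a_{\text{in}}^ib_{\text{in}}^i: 1\le i\le N\}$; $E_L=\{a_{\text{in}}^ib_{\text{out}}^j: i\ge j\}$; $E_R=\{a_{\text{out}}^ib_{\text{in}}^j: i\ge j\}$; $G=(A_{\text{in}}\cup A_{\text{out}}, B_{\text{in}}\cup B_{\text{out}}, M\cup E_L\cup E_R)$ (so $\mu(G)=2N$ and $M$ is maximal). The stream $\pi$ first presents the edges of $M$, then those of $E_L$ and $E_R$, where within $E_L$ the edge $a_{\text{in}}^ib_{\text{out}}^j$ arrives before $a_{\text{in}}^{i'}b_{\text{out}}^{j'}$ only if $i>i'$, or $i=i'$ and $j<j'$; and analogously within $E_R$ for $a_{\text{out}}^ib_{\text{in}}^j$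 versus $a_{\text{out}}^{i'}b_{\text{in}}^{j'}$. Notation: for $U\subseteq A\cup B$ and edge set $F$, $U(F)$ is the set of vertices of $U$ incident to $F$, $\overline{U(F)}=U\setminus U(F)$, and $G[U]$ the induced subgraph, where $A=A_{\text{in}}\cup A_{\text{out}}$, $B=B_{\text{in}}\cup B_{\text{out}}$. $\textsc{Greedy}_d$ on a stream of edges between a ''degree-1 side'' $X$ and a ''degree-$d$ side'' $Y$ starts with $S=\emptyset$ and adds the current edge $xy$ iff $\deg_S(x)=0$ and $\deg_S(y)<d$. Algorithm FAP on input $\pi,M,p,d$: let $M'\subseteq M$ contain each edge of $M$ independently with probability $p$; let $G_L'=G[A(M')\cup\overline{B(M)}]$, $G_R'=G[\overline{A(M)}\cup B(M')]$; $S_L\leftarrow\textsc{Greedy}_d$ on the substream of $\pi$ of edges of $G_L'$ with degree bound $1$ on $A(M')$ and $d$ on $\overline{B(M)}$; $S_R\leftarrow\textsc{Greedy}_d$ on the substream of edges of $G_R'$ with degree bound $1$ on $B(M')$ and $d$ on $\overline{A(M)}$; let $\mathcal{P}$ be the set of paths $(ab',ab,a'b)$ with $ab'\in S_L$, $ab\in M'$, $a'b\in S_R$; return a largest subset $\mathcal{Q}\subseteq\mathcal{P}$ of pairwise vertex-disjoint paths. ''With high probability'' is as $N\to\infty$, and $o(1)$ is as $N\to\infty$. *)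

(* Defs.v *)
From HB Require Import structures.
From mathcomp Require Import all_boot all_order all_algebra.

Set Implicit Arguments.
Unset Strict Implicit.
Unset Printing Implicit Defensive.

Import Order.TTheory GRing.Theory Num.Theory.

Section BipartiteGraphs.

(* A bipartite graph has vertex classes A and B (all of both types), and is   *)
(* given by its edge set E; the edge ab is the pair (a, b).                   *)
Variables A B : finType.
Implicit Types (e : A * B) (E F M S : {set A * B}) (U X Y : {set A + B}).

Definition ends e : {set A + B} := [set inl e.1; inr e.2].

Definition sideA : {set A + B} := [set inl a | a : A].
Definition sideB : {set A + B} := [set inr b | b : B].

Definition matching F : bool :=
  [forall e in F, forall f in F, (e != f) ==> [disjoint ends e & ends f]].

Definition mu E : nat :=
  \max_(F : {set A * B} | (F \subset E) && matching F) #|F|.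

(* U(F) and its complement in U. *)
Definition covered U F : {set A + B} :=
  [set v in U | [exists e in F, v \in ends e]].
Definition uncovered U F : {set A + B} := U :\: covered U F.

(* The edge set of the induced subgraph G[U]. *)
Definition induced E U : {set A * B} := [set e in E | ends e \subset U].

Definition deg S (v : A + B) : nat := #|[set e in S | v \in ends e]|.

(* Degree bound 1 on X and d on Y. *)
Definition greedy_step (d : nat) X Y S e : {set A * B} :=
  if [forall x in ends e :&: X, deg S x == 0] &&
     [forall y in ends e :&: Y, deg S y < d]
  then e |: S else S.

Definition greedy (d : nat) X Y (s : seq (A * B)) : {set A * B} :=
  foldl (greedy_step d X Y) set0 s.

(* A triple (ab', ab, a'b) of edges, standing for the path b' - a - b - a'.   *)
Definition path3 : finType := ((A * B) * (A * B) * (A * B))%type.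

Definition path3_vertices (q : path3) : {set A + B} :=
  ends q.1.1 :|: ends q.1.2 :|: ends q.2.

Definition vertex_disjoint (Q : {set path3}) : bool :=
  [forall q in Q, forall q' in Q,
    (q != q') ==> [disjoint path3_vertices q & path3_vertices q']].

Definition augmenting_path E M (q : path3) : bool :=
  [&& q.1.1 \in E :\: M, q.1.2 \in E :&: M, q.2 \in E :\: M,
      q.1.1.1 == q.1.2.1, q.2.2 == q.1.2.2,
      inr q.1.1.2 \in uncovered sideB M & inl q.2.1 \in uncovered sideA M].

Section FAP.

(* The input (G, stream, M, d), and the outcome M' of the random sampling.    *)
Variables (E : {set A * B}) (s : seq (A * B)) (M : {set A * B}) (d : nat).
Variable M' : {set A * B}.

Definition FAP_GL := induced E (covered sideA M' :|: uncovered sideB M).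
Definition FAP_GR := induced E (uncovered sideA M :|: covered sideB M').

Definition FAP_SL : {set A * B} :=
  greedy d (covered sideA M') (uncovered sideB M)
    [seq e <- s | e \in FAP_GL].
Definition FAP_SR : {set A * B} :=
  greedy d (covered sideB M') (uncovered sideA M)
    [seq e <- s | e \in FAP_GR].

Definition FAP_paths : {set path3} :=
  [set q : path3 | [&& q.1.1 \in FAP_SL, q.1.2 \in M', q.2 \in FAP_SR,
                       q.1.1.1 == q.1.2.1 & q.2.2 == q.1.2.2]].

(* The algorithm may return any largest disjoint subfamily, hence a predicate *)
(* on Q and not a function; FAP_output_exists shows that one exists.          *)
Definition FAP_output (Q : {set path3}) : bool :=
  [&& Q \subset FAP_paths, vertex_disjoint Q &
      [forall Q' : {set path3},
        (Q' \subset FAP_paths) && vertex_disjoint Q' ==> (#|Q'| <= #|Q|)]].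

Lemma FAP_output_exists : exists Q, FAP_output Q.
Proof.
pose C (Q : {set path3}) := (Q \subset FAP_paths) && vertex_disjoint Q.
have C0 : C set0.
  by rewrite /C sub0set; apply/forall_inP => q; rewrite inE.
case: (arg_maxnP (fun Q : {set path3} => #|Q|) C0) => Q /andP[QP QD] Qmax.
exists Q; rewrite /FAP_output QP QD /=.
by apply/forallP => Q'; apply/implyP; apply: Qmax.
Qed.

End FAP.

End BipartiteGraphs.

Section Sampling.
Local Open Scope ring_scope.

(* Probability that M' satisfies the event Ev, where M' contains each element *)
(* of M independently with probability p.                                     *)
Definition sample_prob (R : realFieldType) (T : finType) (p : R)
    (M : {set T}) (Ev : pred {set T}) : R :=
  \sum_(M' in powerset M | Ev M')
    \prod_(e in M) (if e \in M' then p else 1 - p).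

End Sampling.

Section HardInstance.

(* Both vertex classes are 'I_N + 'I_N, with inl for "in" and inr for "out";  *)
(* the indices 1, ..., N are shifted to 0, ..., N - 1.                        *)
Variable N : nat.

Definition side : finType := ('I_N + 'I_N)%type.
Definition hard_edge : finType := (side * side)%type.

Definition a_in (i : 'I_N) : side := inl i.
Definition a_out (i : 'I_N) : side := inr i.
Definition b_in (i : 'I_N) : side := inl i.
Definition b_out (i : 'I_N) : side := inr i.

Definition hard_M : {set hard_edge} := [set (a_in i, b_in i) | i : 'I_N].
Definition hard_EL : {set hard_edge} :=
  [set (a_in i, b_out j) | i in 'I_N, j in 'I_N & j <= i].
Definition hard_ER : {set hard_edge} :=
  [set (a_out i, b_in j) | i in 'I_N, j in 'I_N & j <= i].

Definition hard_G : {set hard_edge} := hard_M :|: hard_EL :|: hard_ER.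

(* The interleaving of E_L with E_R, and the order inside M, are left free.   *)
Definition hard_stream (s : seq hard_edge) : Prop :=
  let before e f := index e s < index f s in
  [/\ uniq s /\ s =i hard_G,
      forall e f, e \in hard_M -> f \in hard_EL :|: hard_ER -> before e f,
      forall i j i' j' : 'I_N, j <= i -> j' <= i' ->
        before (a_in i, b_out j) (a_in i', b_out j') ->
        i' < i \/ i = i' /\ j < j'
    & forall i j i' j' : 'I_N, j <= i -> j' <= i' ->
        before (a_out i, b_in j) (a_out i', b_in j') ->
        i' < i \/ i = i' /\ j < j'].

End HardInstance.

(* Main.v *)
Require Import Defs.
From HB Require Import structures.
From mathcomp Require Import all_boot all_order all_algebra.
From mathcomp Require Import reals topology normedtype sequences.
From mathcomp Require Import zify ring lra.

(* Identify M' with a random index set X. In E_L the vertices a_in^i, i in X, arrive *)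
(* by decreasing i and fill b_out^1, b_out^2, ... in blocks of d, as long as the bin *)
(* index stays below i; so a_in^i gets the bin t %/ d, where t counts the elements   *)
(* of X above i. Symmetrically, b_in^j gets the bin r %/ d counted from the top of   *)
(* A_out, where r counts the elements of X below j. As X has density p, S_L only     *)
(* reaches indices above N p/(d+p) and S_R only those below N d/(d+p). Disjoint      *)
(* paths use distinct bins of B_out, and the about p N (d-p)/(d+p) elements of X     *)
(* between the two thresholds occupy about a d-th of that many bins. The density     *)
(* is only needed on three intervals of indices, where Chebyshev's inequality with   *)
(* deviation N^(3/4) gives it with probability 1 - O(N^(-1/2)).                      *)

Set Implicit Arguments.
Unset Strict Implicit.
Unset Printing Implicit Defensive.

Import Order.TTheory GRing.Theory Num.Theory.
Import numFieldNormedType.Exports.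

(** The proof separates an exact description of a run for a fixed sample from a concentration
    estimate. For fixed M', [bins_filled_by_rank] solves the recursion of the greedy algorithm: the
    item preceded by r sampled items goes to bin r / d, provided that this bin is adjacent to it.
    [FAP_SL_in] and [FAP_SR_in] are its two instances, and [FAP_output_card] deduces the bound on
    disjoint paths.

    The threshold [lo] solves d lo = p (N - lo) up to the error terms, so lo is about N p / (d + p).
    The p (N - lo) sampled indices above [lo] then fill the first [lo] bins of B_out, which include
    all bins adjacent to a_in^i for i below [lo]; the other side is symmetric. The middle interval
    has length about N (d - p) / (d + p), and its sampled indices occupy about N p (d - p) / (d (d +
    p)) bins, which is 2 N p (1 / (d + p) - 1 / (2 d)); [hard_mu_ge] bounds 2 N by mu. The three
    counts are controlled by [sample_chebyshev]; [FAP_hard_prob] combines everything for fixed N and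
    error parameter [delta], and the theorem lets [delta] be N^(-1/4). *)

(** * Ranks in an index set, and the block-filling recursion *)

Section Rank.

Variable N : nat.
Implicit Type X : {set 'I_N}.

Definition rank X (n : nat) : nat := #|[set x in X | x < n]|.

(** Ranks enumerate the elements of [X] below [n] increasingly as 0, 1, 2, ..., so a condition on
    ranks can be counted on an initial interval of integers. *)
Lemma card_rank_count X (P : pred nat) n :
  #|[set x in X | (x < n) && P (rank X x)]| = count P (iota 0 (rank X n)).
Proof.
elim: n => [|n IH].
  have -> : rank X 0 = 0 by rewrite /rank; apply: eq_card0 => x; rewrite !inE andbF.
  by apply: eq_card0 => x; rewrite !inE /= andbF.
have [nX | nX] := boolP [exists x in X, x == n :> nat]; last first.
  have ltn_X x : x \in X -> (x < n.+1) = (x < n).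
    move=> xX; rewrite ltnS leq_eqVlt; case: eqP => //= xn.
    by case/existsP: nX; exists x; rewrite xX xn eqxx.
  have -> : rank X n.+1 = rank X n.
    apply: eq_card => x; rewrite !inE; case: (boolP (x \in X)) => //= xX.
    exact: ltn_X.
  rewrite -IH; apply: eq_card => x; rewrite !inE.
  by case: (boolP (x \in X)) => //= xX; rewrite ltn_X.
case/existsP: nX => y /andP[yX /eqP yn].
have ltnE (x : 'I_N) : (x < n.+1) = (x == y) || (x < n).
  by rewrite ltnS leq_eqVlt -yn.
have yn' : y \notin [set x in X | x < n] by rewrite inE yn ltnn andbF.
have -> : rank X n.+1 = (rank X n).+1.
  have -> : rank X n.+1 = #|y |: [set x in X | x < n]|.
    apply: eq_card => x; rewrite !inE ltnE.
    by case: eqP => [->|//]; rewrite yX.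
  by rewrite cardsU1 yn'.
rewrite -[(rank X n).+1]addn1 iotaD count_cat -IH /= add0n addn0.
set A := [set x in X | (x < n) && _].
have [Pn | /negbTE Pn] := boolP (P (rank X n)).
  transitivity #|y |: A|; last by rewrite cardsU1 inE yn ltnn andbF addnC.
  apply: eq_card => x; rewrite !inE ltnE.
  by case: eqP => [->|//]; rewrite yX yn Pn.
rewrite addn0; apply: eq_card => x; rewrite !inE ltnE.
by case: eqP => [->|//]; rewrite yX yn ltnn Pn.
Qed.

Lemma count_div_eq (d k n : nat) : 0 < d ->
  count (fun t => t %/ d == k) (iota 0 n) = minn d (n - k * d).
Proof.
move=> d0; elim: n => [|n IH]; first by rewrite /= sub0n minn0.
rewrite -addn1 iotaD count_cat IH /= add0n addn0.
have -> : (n %/ d == k) = (k * d <= n < k * d + d).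
  by rewrite addnC -mulSn eqn_leq -ltnS ltn_divLR // leq_divRL // andbC.
move: (k * d) => kd; case: leqP; case: ltnP => /=; lia.
Qed.

(** [W u k] stands for: item u is put into bin k. Induction on u + k works because the recursion
    only looks at smaller bins for the same item and at smaller items for the same bin, all still
    inside the staircase u + k < N. With r the rank of u, the load found in bin k is min(d, r - k
    d), so there is room iff r < (k + 1) d, while all smaller bins refused u iff k <= r / d. *)
Lemma bins_filled_by_rank d X (W : 'I_N -> 'I_N -> bool) : 0 < d ->
  (forall u k : 'I_N, u \in X -> u + k < N ->
    W u k = [forall k' : 'I_N, (k' < k) ==> ~~ W u k'] &&
            (#|[set x in X | (x < u) && W x k]| < d)) ->
  forall u k : 'I_N, u \in X -> u + k < N -> W u k = (rank X u %/ d == k).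
Proof.
move=> d0 Wrec u k; have [n] := ubnP (u + k).
elim: n u k => // n IH u k ltn uX ukN; rewrite Wrec //.
have -> : #|[set x in X | (x < u) && W x k]| = minn d (rank X u - k * d).
  rewrite -count_div_eq // -card_rank_count; apply: eq_card => x; rewrite !inE.
  case: (boolP (x \in X)) => //= xX; case: ltnP => //= xu.
  by rewrite IH //; lia.
have -> : [forall k' : 'I_N, (k' < k) ==> ~~ W u k'] = (k <= rank X u %/ d).
  apply/forallP/idP => [noW | kr k'].
    rewrite leqNgt; apply/negP => rk.
    have rN : rank X u %/ d < N by apply: ltn_trans rk _.
    have /implyP/(_ rk) := noW (Ordinal rN).
    by rewrite IH //= ?eqxx //; lia.
  by apply/implyP => k'k; rewrite IH //; lia.
rewrite eqn_leq andbC; congr (_ && _).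
rewrite -[_ %/ d <= k]ltnS ltn_divLR // mulSn.
move: (k * d) => kd; lia.
Qed.

End Rank.

(** * The greedy algorithm as a recursion on edges *)

Section Greedy.

Variables (A B : finType) (d : nat) (X Y : {set A + B}).
Implicit Types (s : seq (A * B)) (S : {set A * B}) (e f : A * B).

Definition greedy_accepts S e : bool :=
  [forall x in ends e :&: X, deg S x == 0] &&
  [forall y in ends e :&: Y, deg S y < d].

Lemma greedy_rcons s e :
  greedy d X Y (rcons s e) =
  if greedy_accepts (greedy d X Y s) e then e |: greedy d X Y s
  else greedy d X Y s.
Proof. by rewrite /greedy -cats1 foldl_cat. Qed.

Lemma greedy_mem s e : e \in greedy d X Y s -> e \in s.
Proof.
elim/last_ind: s => [|s f IH]; first by rewrite inE.
rewrite greedy_rcons mem_rcons inE; case: ifP => _; last by move/IH ->; rewrite orbT.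
by rewrite !inE => /orP[-> // | /IH ->]; rewrite orbT.
Qed.

(** Accepted edges are never removed, so the set held when [e] arrives can be read off the final
    output by comparing positions. This replaces the fold by the kind of recursion that
    [bins_filled_by_rank] solves. *)
Lemma greedyE s e : uniq s -> e \in s ->
  (e \in greedy d X Y s) =
  greedy_accepts [set f in greedy d X Y s | index f s < index e s] e.
Proof.
elim/last_ind: s e => [//|s g IH] e; rewrite rcons_uniq => /andP[gs us].
have idx f : f \in s -> index f (rcons s g) = index f s.
  by move=> fs; rewrite -cats1 index_cat fs.
have idxg : index g (rcons s g) = size s.
  by rewrite -cats1 index_cat (negbTE gs) /= eqxx addn0.
have ng : g \notin greedy d X Y s by apply: contra gs; apply: greedy_mem.
have memr f : f != g -> (f \in greedy d X Y (rcons s g)) = (f \in greedy d X Y s).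
  by move=> fg; rewrite greedy_rcons; case: ifP; rewrite // !inE (negbTE fg).
rewrite mem_rcons inE; case: (eqVneq e g) => [-> _ | eg /= es].
  rewrite idxg (_ : [set f in _ | _] = greedy d X Y s).
    by rewrite greedy_rcons; case: ifP; rewrite ?inE ?eqxx // (negbTE ng).
  apply/setP => f; rewrite inE; case: (eqVneq f g) => [-> | fg].
    by rewrite idxg ltnn andbF (negbTE ng).
  rewrite memr //; apply: andb_idr => /greedy_mem fs.
  by rewrite idx // index_mem.
rewrite memr // IH //; congr greedy_accepts; apply/setP => f; rewrite !inE.
case: (eqVneq f g) => [-> | fg]; last first.
  rewrite memr //; case: (boolP (f \in _)) => //= /greedy_mem fs.
  by rewrite !idx.
rewrite (negbTE ng) idxg idx //= ltnNge ltnW ?index_mem //=; by rewrite andbF.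
Qed.

(* Items [u] carry the degree bound 1 and bins [k] the bound [d]. Only the order  *)
(* between edges sharing an item or a bin matters, so this covers both E_L (with  *)
(* [u] the reversed index of a_in) and E_R (with [k] the reversed index of a_out). *)
Lemma greedy_staircase N (I : {set 'I_N}) (phi : 'I_N -> 'I_N -> A * B)
    (x y : 'I_N -> A + B) s :
  0 < d -> uniq s ->
  (forall e, reflect (exists u k : 'I_N, [/\ u \in I, u + k < N & e = phi u k]) (e \in s)) ->
  (forall u k, ends (phi u k) = [set x u; y k]) ->
  injective x -> injective y -> (forall u k, x u != y k) ->
  (forall u, u \in I -> x u \in X) -> (forall k, y k \in Y) -> [disjoint X & Y] ->
  (forall u k k' : 'I_N, u \in I -> u + k' < N -> k < k' ->
     index (phi u k) s < index (phi u k') s) ->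
  (forall u u' k : 'I_N, u \in I -> u' \in I -> u' + k < N -> u < u' ->
     index (phi u k) s < index (phi u' k) s) ->
  forall u k : 'I_N, u \in I -> u + k < N ->
    (phi u k \in greedy d X Y s) = (rank I u %/ d == k).
Proof.
move=> d0 us sP endsE xinj yinj xy xX yY dXY bin_lt item_lt.
have phi_inj u k u' k' : phi u k = phi u' k' -> u = u' /\ k = k'.
  move=> E; have := endsE u k; rewrite E endsE => /setP H.
  move: (H (x u)) (H (y k)); rewrite !inE !eqxx orbT (negbTE (xy _ _)) orbF.
  by rewrite [y k == x _]eq_sym (negbTE (xy _ _)) /= => /eqP/xinj -> /eqP/yinj ->.
apply: (@bins_filled_by_rank _ d I (fun u k => phi u k \in greedy d X Y s)) => //.
move=> u k uI ukN.
have es : phi u k \in s by apply/sP; exists u, k.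
rewrite greedyE // /greedy_accepts endsE; set S := [set f in _ | _].
have xuY : x u \notin Y.
  by apply/negP => xuY; have /pred0P/(_ (x u)) := dXY; rewrite /= xX // xuY.
have ykX : y k \notin X.
  by apply/negP => ykX; have /pred0P/(_ (y k)) := dXY; rewrite /= ykX yY.
have -> : [forall z in [set x u; y k] :&: X, deg S z == 0] = (deg S (x u) == 0).
  apply/forall_inP/idP => [/(_ (x u)) -> // | dS z]; first by rewrite !inE eqxx xX.
  by rewrite !inE => /andP[/orP[/eqP->|/eqP->]] //; rewrite (negbTE ykX).
have -> : [forall z in [set x u; y k] :&: Y, deg S z < d] = (deg S (y k) < d).
  apply/forall_inP/idP => [/(_ (y k)) -> // | dS z]; first by rewrite !inE eqxx yY orbT.
  by rewrite !inE => /andP[/orP[/eqP->|/eqP->]] //; rewrite (negbTE xuY).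
(* The item is free iff no smaller bin took it, by [bin_lt]; the load of the bin counts the smaller
   items that it took, by [item_lt]. *)
congr (_ && (_ < d)).
  rewrite /deg cards_eq0; apply/eqP/forallP => [S0 k' | noS].
    apply/implyP => k'k; apply/negP => fS.
    have /setP/(_ (phi u k')) := S0.
    by rewrite in_set /S in_set fS bin_lt //= endsE set21 in_set0.
  apply/setP => f; rewrite in_set /S in_set in_set0.
  apply/negP => /andP[/andP[fG flt] xf].
  have /sP[u' [k' [u'I uk' Ef]]] := greedy_mem fG; subst f.
  move: xf; rewrite endsE !inE (negbTE (xy _ _)) orbF => /eqP/xinj E; subst u'.
  have [kk'|] := ltnP k' k; first by have /implyP/(_ kk')/negP := noS k'.
  rewrite leq_eqVlt => /orP[/eqP/val_inj kk' | kk']; first by rewrite kk' ltnn in flt.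
  by have := bin_lt _ _ _ uI uk' kk'; rewrite ltnNge ltnW.
rewrite /deg -(@card_imset _ _ (phi^~ k)); last by move=> u1 u2 /phi_inj[].
apply: eq_card => f; rewrite in_set /S in_set.
apply/idP/imsetP => [/andP[/andP[fG flt] yf] | ].
  have /sP[u' [k' [u'I uk' Ef]]] := greedy_mem fG; subst f.
  move: yf; rewrite endsE !inE [y k == x _]eq_sym (negbTE (xy _ _)) /=.
  move=> /eqP/yinj E; subst k'; exists u' => //; rewrite inE u'I fG andbT /=.
  rewrite ltnNge leq_eqVlt; apply/negP => /orP[/eqP/val_inj uu'|uu'].
    by rewrite uu' ltnn in flt.
  by have := item_lt _ _ _ uI u'I uk' uu'; rewrite ltnNge ltnW.
case=> u'; rewrite inE => /and3P[u'I u'u fG] ->.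
by rewrite fG endsE !inE eqxx orbT andbT item_lt.
Qed.

End Greedy.

(** Carries the arrival order of the stream over to the substreams read by the two greedy runs. *)
Lemma index_filter_ltn (T : eqType) (P : pred T) (s : seq T) x y :
  P x -> P y ->
  (index x [seq z <- s | P z] < index y [seq z <- s | P z]) = (index x s < index y s).
Proof.
move=> Px Py; elim: s => //= z s IH.
case: ifP => Pz /=; first by do 2!case: eqP.
have zx : z == x = false by apply: contraFF Pz => /eqP ->.
have zy : z == y = false by apply: contraFF Pz => /eqP ->.
by rewrite zx zy ltnS.
Qed.

Lemma inl_in_sideA (A B : finType) (a : A) : inl a \in sideA A B.
Proof. exact: imset_f. Qed.

Lemma inr_in_sideA (A B : finType) (b : B) : (inr b \in sideA A B) = false.
Proof. by apply/negP => /imsetP[]. Qed.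

Lemma inl_in_sideB (A B : finType) (a : A) : (inl a \in sideB A B) = false.
Proof. by apply/negP => /imsetP[]. Qed.

Lemma inr_in_sideB (A B : finType) (b : B) : inr b \in sideB A B.
Proof. exact: imset_f. Qed.

(** * The run of FAP on the hard instance for a fixed sample *)

Section HardInstanceRun.

Variables (N d : nat) (s : seq (hard_edge N)) (M' : {set hard_edge N}).
Hypotheses (d_gt0 : 0 < d) (s_hard : hard_stream s) (M'M : M' \subset hard_M N).

Definition matched_edge (i : 'I_N) : hard_edge N := (a_in i, b_in i).

Lemma matched_edge_inj : injective matched_edge.
Proof. by move=> i j []. Qed.

Definition sampled : {set 'I_N} := [set i | matched_edge i \in M'].

Lemma hard_M_P e : reflect (exists i, e = matched_edge i) (e \in hard_M N).
Proof. by apply: (iffP imsetP) => [[i _ ->] | [i ->]]; exists i. Qed.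

Lemma hard_EL_in i j : ((a_in i, b_out j) \in hard_EL N) = (j <= i).
Proof.
apply/imset2P/idP => [[i' j' _] | ji].
  by rewrite inE => /andP[_ ji] [-> ->].
by exists i j => //; rewrite inE.
Qed.

Lemma hard_ER_in i j : ((a_out i, b_in j) \in hard_ER N) = (j <= i).
Proof.
apply/imset2P/idP => [[i' j' _] | ji].
  by rewrite inE => /andP[_ ji] [-> ->].
by exists i j => //; rewrite inE.
Qed.

Lemma hard_G_in (e : hard_edge N) :
  e \in hard_G N =
  match e with
  | (inl i, inl j) => i == j
  | (inl i, inr j) => j <= i
  | (inr i, inl j) => j <= i
  | (inr i, inr j) => false
  end.
Proof.
have ELP e' : e' \in hard_EL N -> exists i j, e' = (a_in i, b_out j).
  by case/imset2P => i j _ _ ->; exists i, j.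
have ERP e' : e' \in hard_ER N -> exists i j, e' = (a_out i, b_in j).
  by case/imset2P => i j _ _ ->; exists i, j.
rewrite !inE; case: e => [[i|i] [j|j]].
- have -> : ((inl i, inl j) \in hard_EL N) = false.
    by apply/negP => /ELP[? [? ]].
  have -> : ((inl i, inl j) \in hard_ER N) = false.
    by apply/negP => /ERP[? [? ]].
  rewrite !orbF; apply/hard_M_P/eqP => [[k [-> ->]] // | ->]; by exists j.
- rewrite hard_EL_in.
  have -> : ((inl i, inr j) \in hard_M N) = false by apply/negP => /hard_M_P[].
  have -> : ((inl i, inr j) \in hard_ER N) = false.
    by apply/negP => /ERP[? [? ]].
  by rewrite orbF.
- rewrite hard_ER_in.
  have -> : ((inr i, inl j) \in hard_M N) = false by apply/negP => /hard_M_P[].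
  have -> // : ((inr i, inl j) \in hard_EL N) = false.
    by apply/negP => /ELP[? [? ]].
- have -> : ((inr i, inr j) \in hard_M N) = false by apply/negP => /hard_M_P[].
  have -> : ((inr i, inr j) \in hard_EL N) = false.
    by apply/negP => /ELP[? [? ]].
  by apply/negP => /ERP[? [? ]].
Qed.

Lemma covered_A_sampled v :
  (v \in covered (sideA _ _) M') = if v is inl (inl i) then i \in sampled else false.
Proof.
rewrite inE; case: v => [a|b]; last by rewrite inr_in_sideA.
rewrite inl_in_sideA /=; apply/existsP/idP => [[e /andP[eM' ae]] | ].
  have /hard_M_P[i Ee] := subsetP M'M _ eM'; subst e.
  by move: ae; rewrite !inE orbF => /eqP[->]; rewrite /a_in inE.
case: a => // i; rewrite inE => iM'; exists (matched_edge i).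
by rewrite iM' !inE eqxx.
Qed.

Lemma covered_B_sampled v :
  (v \in covered (sideB _ _) M') = if v is inr (inl i) then i \in sampled else false.
Proof.
rewrite inE; case: v => [a|b]; first by rewrite inl_in_sideB.
rewrite inr_in_sideB /=; apply/existsP/idP => [[e /andP[eM' ae]] | ].
  have /hard_M_P[i Ee] := subsetP M'M _ eM'; subst e.
  by move: ae; rewrite !inE /= => /eqP[->]; rewrite /b_in inE.
case: b => // i; rewrite inE => iM'; exists (matched_edge i).
by rewrite iM' !inE eqxx orbT.
Qed.

Lemma uncovered_A v :
  (v \in uncovered (sideA _ _) (hard_M N)) = if v is inl (inr i) then true else false.
Proof.
rewrite !inE; case: v => [a|b]; last by rewrite inr_in_sideA andbF.
rewrite inl_in_sideA andbT /=; case: a => i.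
  apply/negbTE; rewrite negbK; apply/existsP; exists (matched_edge i).
  by rewrite !inE eqxx andbT; apply/hard_M_P; exists i.
apply/existsP => -[e /andP[/hard_M_P[j ->]]].
by rewrite !inE orbF.
Qed.

Lemma uncovered_B v :
  (v \in uncovered (sideB _ _) (hard_M N)) = if v is inr (inr i) then true else false.
Proof.
rewrite !inE; case: v => [a|b]; first by rewrite inl_in_sideB andbF.
rewrite inr_in_sideB andbT /=; case: b => i.
  apply/negbTE; rewrite negbK; apply/existsP; exists (matched_edge i).
  by rewrite !inE eqxx orbT andbT; apply/hard_M_P; exists i.
apply/existsP => -[e /andP[/hard_M_P[j ->]]].
by rewrite !inE.
Qed.

Lemma FAP_GL_in (e : hard_edge N) :
  e \in FAP_GL (hard_G N) (hard_M N) M' =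
  if e is (inl i, inr j) then (i \in sampled) && (j <= i) else false.
Proof.
rewrite inE hard_G_in /ends subUset !sub1set !in_setU !covered_A_sampled !uncovered_B.
by case: e => [[i|i] [j|j]] //=; rewrite ?andbF ?andbT ?orbF //= andbC.
Qed.

Lemma FAP_GR_in (e : hard_edge N) :
  e \in FAP_GR (hard_G N) (hard_M N) M' =
  if e is (inr i, inl j) then (j \in sampled) && (j <= i) else false.
Proof.
rewrite inE hard_G_in /ends subUset !sub1set !in_setU !covered_B_sampled !uncovered_A.
by case: e => [[i|i] [j|j]] //=; rewrite ?andbF ?andbT ?orbF //= andbC.
Qed.

(** [hard_stream] only says that arriving earlier implies the lexicographic condition. That
    condition is asymmetric and distinct edges have distinct positions, so the converse follows. *)
Lemma stream_EL_before (i j i' j' : 'I_N) : j <= i -> j' <= i' ->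
  i' < i \/ i = i' /\ j < j' ->
  index (a_in i, b_out j) s < index (a_in i', b_out j') s.
Proof.
have [[_ sG] _ ord _] := s_hard; move=> ji ji' lt.
have es : (a_in i, b_out j) \in s by rewrite sG hard_G_in.
have es' : (a_in i', b_out j') \in s by rewrite sG hard_G_in.
rewrite ltnNge leq_eqVlt; apply/negP => /orP[/eqP E | /(ord _ _ _ _ ji' ji)].
  have [E1 E2] := index_inj (a_in i, b_in i) es' es E.
  by move: lt; rewrite E1 E2 !ltnn => -[|[]].
case: lt => [lt | [-> lt]] [lt' | [E lt']]; rewrite ?E in lt lt' *; lia.
Qed.

Lemma stream_ER_before (i j i' j' : 'I_N) : j <= i -> j' <= i' ->
  i' < i \/ i = i' /\ j < j' ->
  index (a_out i, b_in j) s < index (a_out i', b_in j') s.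
Proof.
have [[_ sG] _ _ ord] := s_hard; move=> ji ji' lt.
have es : (a_out i, b_in j) \in s by rewrite sG hard_G_in.
have es' : (a_out i', b_in j') \in s by rewrite sG hard_G_in.
rewrite ltnNge leq_eqVlt; apply/negP => /orP[/eqP E | /(ord _ _ _ _ ji' ji)].
  have [E1 E2] := index_inj (a_in i, b_in i) es' es E.
  by move: lt; rewrite E1 E2 !ltnn => -[|[]].
case: lt => [lt | [-> lt]] [lt' | [E lt']]; rewrite ?E in lt lt' *; lia.
Qed.

Local Notation sL := [seq e <- s | e \in FAP_GL (hard_G N) (hard_M N) M'].
Local Notation sR := [seq e <- s | e \in FAP_GR (hard_G N) (hard_M N) M'].

Lemma stream_GL_in e : (e \in sL) = (e \in FAP_GL (hard_G N) (hard_M N) M').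
Proof.
have [[_ sG] _ _ _] := s_hard.
rewrite mem_filter sG andb_idr // FAP_GL_in hard_G_in.
by case: e => [[?|?] [?|?]] // /andP[].
Qed.

Lemma stream_GR_in e : (e \in sR) = (e \in FAP_GR (hard_G N) (hard_M N) M').
Proof.
have [[_ sG] _ _ _] := s_hard.
rewrite mem_filter sG andb_idr // FAP_GR_in hard_G_in.
by case: e => [[?|?] [?|?]] // /andP[].
Qed.

Lemma FAP_SL_sub (e : hard_edge N) :
  e \in FAP_SL (hard_G N) s (hard_M N) d M' ->
  e \in FAP_GL (hard_G N) (hard_M N) M'.
Proof. by move/greedy_mem; rewrite -stream_GL_in. Qed.

Lemma FAP_SR_sub (e : hard_edge N) :
  e \in FAP_SR (hard_G N) s (hard_M N) d M' ->
  e \in FAP_GR (hard_G N) (hard_M N) M'.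
Proof. by move/greedy_mem; rewrite -stream_GR_in. Qed.

(** The items a_in^i arrive by decreasing i, so [greedy_staircase] is applied to reversed item
    indices: j <= i becomes u + k < N, and the rank of the reversed index counts the sampled indices
    above i. *)
Lemma FAP_SL_in (i j : 'I_N) : i \in sampled -> j <= i ->
  ((a_in i, b_out j) \in FAP_SL (hard_G N) s (hard_M N) d M') =
  (#|[set x in sampled | i < x]| %/ d == j).
Proof.
move=> iX ji; have [[us _] _ _ _] := s_hard.
have iN := ltn_ord i.
pose I : {set 'I_N} := [set u | rev_ord u \in sampled].
pose phi (u k : 'I_N) : hard_edge N := (a_in (rev_ord u), b_out k).
have GLphi (u k : 'I_N) : u \in I -> u + k < N ->
    phi u k \in FAP_GL (hard_G N) (hard_M N) M'.
  by rewrite FAP_GL_in /= inE => -> /=; lia.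
have before (u k u' k' : 'I_N) : u \in I -> u' \in I -> u + k < N -> u' + k' < N ->
    u < u' \/ u = u' /\ k < k' -> index (phi u k) sL < index (phi u' k') sL.
  move=> uI u'I uk uk' lt; rewrite index_filter_ltn ?GLphi //.
  apply: stream_EL_before; rewrite /=; try lia.
  by case: lt => [lt | [-> lt]]; [left; have := ltn_ord u'; lia | right].
have -> : #|[set x in sampled | i < x]| = rank I (rev_ord i).
  rewrite -(card_imset _ rev_ord_inj); apply: eq_card => x.
  rewrite -[x]rev_ordK mem_imset ?rev_ord_inj //; last exact: rev_ord_inj.
  by rewrite !inE rev_ordK /=; congr (_ && _); have := ltn_ord x; lia.
have -> : (a_in i, b_out j) = phi (rev_ord i) j by rewrite /phi rev_ordK.
apply: (greedy_staircase (x := fun u => inl (a_in (rev_ord u)))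
                         (y := fun k => inr (b_out k))) => //.
- exact: filter_uniq.
- move=> e; rewrite stream_GL_in; apply: (iffP idP) => [|[u [k [uI uk ->]]]];
    last exact: GLphi.
  rewrite FAP_GL_in; case: e => [[i'|i'] [j'|j']] // /andP[iX' ji'].
  exists (rev_ord i'), j'; rewrite inE /phi rev_ordK; split => //=.
  by have := ltn_ord i'; lia.
- exact: (inj_comp (inj_comp inl_inj inl_inj) rev_ord_inj).
- by move=> k k' [].
- by move=> u; rewrite inE covered_A_sampled.
- by move=> k; rewrite uncovered_B.
- rewrite disjoint_subset; apply/subsetP => v; rewrite covered_A_sampled !inE.
  by case: v => [[?|?]|?] //; rewrite inl_in_sideB andbF.
- by move=> u k k' uI uk kk'; apply: before => //; [lia | right].
- by move=> u u' k uI u'I uk uu'; apply: before => //; [lia | left].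
- by rewrite inE rev_ordK.
- by rewrite /=; lia.
Qed.

(** Here the bins a_out^i are the ones visited by decreasing index, so they are renumbered and
    [N - i.+1] is the value of [rev_ord i]. The order now runs through bins first and items second,
    the opposite of [FAP_SL_in]. *)
Lemma FAP_SR_in (i j : 'I_N) : j \in sampled -> j <= i ->
  ((a_out i, b_in j) \in FAP_SR (hard_G N) s (hard_M N) d M') =
  (#|[set x in sampled | x < j]| %/ d == N - i.+1).
Proof.
move=> jX ji; have [[us _] _ _ _] := s_hard.
have iN := ltn_ord i.
pose phi (u k : 'I_N) : hard_edge N := (a_out (rev_ord k), b_in u).
have GRphi (u k : 'I_N) : u \in sampled -> u + k < N ->
    phi u k \in FAP_GR (hard_G N) (hard_M N) M'.
  by rewrite FAP_GR_in /= => -> /=; lia.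
have before (u k u' k' : 'I_N) : u \in sampled -> u' \in sampled ->
    u + k < N -> u' + k' < N ->
    k < k' \/ k = k' /\ u < u' -> index (phi u k) sR < index (phi u' k') sR.
  move=> uI u'I uk uk' lt; rewrite index_filter_ltn ?GRphi //.
  apply: stream_ER_before; rewrite /=; try lia.
  by case: lt => [lt | [-> lt]]; [left; have := ltn_ord k'; lia | right].
have -> : (a_out i, b_in j) = phi j (rev_ord i) by rewrite /phi rev_ordK.
apply: (greedy_staircase (x := fun u => inr (b_in u))
                         (y := fun k => inl (a_out (rev_ord k)))) => //.
- exact: filter_uniq.
- move=> e; rewrite stream_GR_in; apply: (iffP idP) => [|[u [k [uI uk ->]]]];
    last exact: GRphi.
  rewrite FAP_GR_in; case: e => [[i'|i'] [j'|j']] // /andP[iX' ji'].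
  exists j', (rev_ord i'); rewrite /phi rev_ordK; split => //=.
  by have := ltn_ord i'; lia.
- by move=> u k; rewrite /ends setUC.
- by move=> u u' [].
- exact: (inj_comp (inj_comp inl_inj inr_inj) rev_ord_inj).
- by move=> u uX; rewrite covered_B_sampled.
- by move=> k; rewrite uncovered_A.
- rewrite disjoint_subset; apply/subsetP => v; rewrite covered_B_sampled !inE.
  by case: v => [?|[?|?]] //; rewrite inr_in_sideA andbF.
- by move=> u k k' uI uk kk'; apply: before => //; [lia | left].
- by move=> u u' k uI u'I uk uu'; apply: before => //; [lia | right].
- by rewrite /=; lia.
Qed.

(* The two hypotheses say that the sampled indices [>= lo] fill the first [lo] bins  *)
(* of B_out, and those [< N - lo] the last [lo] bins of A_out; hence no path runs    *)
(* through an index outside [lo, N - lo). The [+ 2] counts two partially used bins.  *)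
Lemma FAP_output_card lo (Q : {set path3 (side N) (side N)}) :
  d * lo <= #|[set x in sampled | lo <= x]| ->
  d * lo <= #|[set x in sampled | x < N - lo]| ->
  Q \subset FAP_paths (hard_G N) s (hard_M N) d M' -> vertex_disjoint Q ->
  #|Q| <= #|[set x in sampled | lo <= x < N - lo]| %/ d + 2.
Proof.
move=> full_L full_R /subsetP QP Qdisj.
pose c := #|[set x in sampled | N - lo <= x]|.
pose m := #|[set x in sampled | lo <= x < N - lo]|.
have pathP q : q \in Q -> exists2 k : 'I_N, q.1.1.2 = b_out k & c %/ d <= k <= (c + m) %/ d.
  move/QP; rewrite inE => /and5P[qL qM qR /eqP qa /eqP qb].
  have /hard_M_P[i Ei] := subsetP M'M _ qM.
  move: qL qM qR qa qb; rewrite Ei; case: q {Ei} => [[[a b'] e] [a' b]] /= qL qM qR qa qb.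
  subst a b.
  have := FAP_SL_sub qL; rewrite FAP_GL_in; case: b' qL => // k qL /andP[iX ki].
  have := FAP_SR_sub qR; rewrite FAP_GR_in; case: a' qR => // i' qR /andP[_ ii'].
  move: qL qR; rewrite FAP_SL_in // FAP_SR_in // => /eqP kE /eqP rE.
  exists k => //.
  (* For i < lo every sampled index from [lo] on lies above i, so the bin of a_in^i would be at
     least [lo], against k <= i. *)
  have lo_i : lo <= i.
    rewrite leqNgt; apply/negP => ilo.
    suff : lo <= k by lia.
    rewrite -kE leq_divRL // mulnC; apply: (leq_trans full_L); apply: subset_leq_card.
    by apply/subsetP => x; rewrite !inE => /andP[-> lox]; apply: leq_trans lox.
  (* For i >= N - lo the reversed bin index would be at least [lo], forcing i' < N - lo <= i,
     against i <= i'. *)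
  have i_hi : i < N - lo.
    rewrite ltnNge; apply/negP => hii.
    suff : lo <= N - i'.+1 by have := ltn_ord i; lia.
    rewrite -rE leq_divRL // mulnC; apply: (leq_trans full_R); apply: subset_leq_card.
    by apply/subsetP => x; rewrite !inE => /andP[-> xhi]; apply: leq_trans xhi hii.
  rewrite -kE !leq_div2r //.
    apply: leq_trans (leq_card_setU _ _); apply: subset_leq_card.
    apply/subsetP => x; rewrite !inE => /andP[-> ix] /=.
    by case: leqP => //= _; lia.
  by apply: subset_leq_card; apply/subsetP => x; rewrite !inE => /andP[-> hx] /=; lia.
(* The default 0 is never taken on [Q]: by [pathP] the vertex lies in B_out. *)
pose bin (q : path3 (side N) (side N)) : nat := if q.1.1.2 is inr k then k : nat else 0.
have bin_inj : {in Q &, injective bin}.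
  move=> q q' qQ q'Q; have [k Ek _] := pathP _ qQ; have [k' Ek' _] := pathP _ q'Q.
  rewrite /bin Ek Ek' /= => /val_inj kk'; apply/eqP; apply: contraT => nqq'.
  have /forall_inP/(_ _ qQ)/forall_inP/(_ _ q'Q)/implyP/(_ nqq') := Qdisj.
  move/pred0P/(_ (inr (b_out k))); rewrite /= /path3_vertices !inE Ek Ek' kk' eqxx.
  by rewrite !orbT.
rewrite cardE -(size_map bin).
apply: (@leq_trans (size (iota (c %/ d) ((c + m) %/ d - c %/ d).+1))).
  apply: uniq_leq_size.
    by rewrite map_inj_in_uniq ?enum_uniq // => q q'; rewrite !mem_enum; apply: bin_inj.
  move=> k /mapP[q]; rewrite mem_enum => /pathP[k' Ek' /andP[ck kc]] ->.
  by rewrite mem_iota /bin Ek' ck /=; lia.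
by rewrite size_iota addn2 ltnS leq_subLR -addn1 addnA leq_divDl.
Qed.

Lemma FAP_path_augmenting q :
  q \in FAP_paths (hard_G N) s (hard_M N) d M' ->
  augmenting_path (hard_G N) (hard_M N) q.
Proof.
rewrite inE => /and5P[qL qM qR qa qb].
have /hard_M_P[i Ei] := subsetP M'M _ qM.
have := FAP_SL_sub qL; have := FAP_SR_sub qR; rewrite FAP_GL_in FAP_GR_in.
move: qa qb; rewrite /augmenting_path => -> ->; rewrite uncovered_A uncovered_B.
rewrite !in_setD in_setI (subsetP M'M _ qM) Ei !hard_G_in /=.
case: q {qL qM qR Ei} => [[[[?|i1] [?|j1]] e] [[?|i2] [?|j2]]] //=.
move=> /andP[_ ->] /andP[_ ->]; rewrite eqxx !andbT.
by apply/andP; split; apply/negP => /hard_M_P[].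
Qed.

End HardInstanceRun.

(** The diagonals i = j of E_L and E_R together form a perfect matching. *)
Lemma hard_mu_ge N : 2 * N <= mu (hard_G N).
Proof.
pose f (x : side N) : hard_edge N :=
  match x with inl i => (a_in i, b_out i) | inr i => (a_out i, b_in i) end.
have finj : injective f by case=> i [] j [] // ->.
have -> : 2 * N = #|[set f x | x : side N]|.
  by rewrite card_imset // card_sum card_ord mul2n addnn.
apply: (@leq_bigmax_cond _ _ (fun F : {set hard_edge N} => #|F|)).
apply/andP; split.
  by apply/subsetP => e /imsetP[[i|i] _ ->]; rewrite hard_G_in /=.
apply/forall_inP => e /imsetP[x _ ->]; apply/forall_inP => e' /imsetP[x' _ ->].
apply/implyP => nxx'; rewrite disjoint_subset; apply/subsetP => v; rewrite !inE.
have {}nxx' : x != x' by apply: contra nxx' => /eqP ->.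
case: x x' nxx' => i [] j nij /orP[] /eqP ->; apply/negP => /orP[] /eqP [] // E.
all: by rewrite E eqxx in nij.
Qed.

Local Open Scope classical_set_scope.
Local Open Scope ring_scope.


(** * Moments and tail bounds for independent sampling *)

Section SamplingBounds.

Variables (R : realFieldType) (T : finType) (p : R).
Implicit Types (M K : {set T}) (P Q : pred {set T}).

Lemma prod_add_powerset M (F G : T -> R) :
  \sum_(J in powerset M) \prod_(i in M) (if i \in J then F i else G i)
  = \prod_(i in M) (F i + G i).
Proof.
(* Outside [M], the value 0 of [F'] kills the sets not contained in [M], and the value 1 of [G'] is
   neutral; distributivity over all sets thus restricts to the powerset of [M]. *)
pose F' i := if i \in M then F i else 0.
pose G' i := if i \in M then G i else 1.
have -> : \prod_(i in M) (F i + G i) = \prod_i (F' i + G' i).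
  rewrite big_mkcond /=; apply: eq_bigr => i _; rewrite /F' /G'.
  by case: ifP; rewrite ?add0r.
rewrite (bigA_distr 1 +%R) big_mkcond /=; apply: eq_bigr => J _.
rewrite powersetE; case: ifP => [/subsetP sJM | /negbT /subsetPn[i iJ niM]].
  rewrite big_mkcond /=; apply: eq_bigr => i _; rewrite /F' /G'.
  case: (boolP (i \in J)) => iJ; first by rewrite sJM.
  by [].
by rewrite (bigD1 i) //= iJ /F' (negbTE niM) mul0r.
Qed.

Definition sample_weight M (J : {set T}) : R :=
  \prod_(e in M) (if e \in J then p else 1 - p).

(** This is independence: the expectation of a product of functions of single indicators factors. *)
Lemma sample_expectation_prod M (g : T -> bool -> R) :
  \sum_(J in powerset M) sample_weight M J * \prod_(e in M) g e (e \in J)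
  = \prod_(e in M) (p * g e true + (1 - p) * g e false).
Proof.
rewrite -prod_add_powerset; apply: eq_bigr => J _.
by rewrite -big_split /=; apply: eq_bigr => e _; case: ifP.
Qed.

Lemma sample_covariance M e f : e \in M -> f \in M ->
  \sum_(J in powerset M)
    sample_weight M J * (((e \in J)%:R - p) * ((f \in J)%:R - p))
  = if e == f then p * (1 - p) else 0.
Proof.
move=> eM fM.
(* One centred factor sits at e and one at f. For e = f they meet at one element and give the
   variance p (1 - p); otherwise each has mean 0. *)
pose g x (b : bool) : R := (if x == e then b%:R - p else 1) *
                           (if x == f then b%:R - p else 1).
transitivity (\sum_(J in powerset M) sample_weight M J * \prod_(x in M) g x (x \in J)).
  apply: eq_bigr => J _; congr (_ * _).
  rewrite big_split /= (bigD1 e) //= eqxx big1 ?mulr1; last first.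
    by move=> x /andP[_ /negbTE ->].
  congr (_ * _); rewrite (bigD1 f) //= eqxx big1 ?mulr1 //.
  by move=> x /andP[_ /negbTE ->].
rewrite sample_expectation_prod (bigD1 e) //= /g eqxx.
case: (eqVneq e f) => [<- | nef]; last by rewrite /=; ring.
rewrite big1 => [|x /andP[_ /negbTE ->]] /=; ring.
Qed.

Lemma sample_variance M K : K \subset M ->
  \sum_(J in powerset M) sample_weight M J * (#|J :&: K|%:R - p * #|K|%:R) ^+ 2
  = p * (1 - p) * #|K|%:R.
Proof.
move=> /subsetP KM.
transitivity (\sum_(J in powerset M) \sum_(e in K) \sum_(f in K)
    sample_weight M J * (((e \in J)%:R - p) * ((f \in J)%:R - p))).
  apply: eq_bigr => J _.
  have -> : #|J :&: K|%:R - p * #|K|%:R = \sum_(e in K) ((e \in J)%:R - p).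
    rewrite sumrB sumr_const mulr_natr; congr (_ - _).
    rewrite -sum1_card natr_sum big_mkcond [RHS]big_mkcond /=.
    by apply: eq_bigr => e _; rewrite inE; case: (e \in J); case: (e \in K).
  rewrite expr2 big_distrlr /= mulr_sumr; apply: eq_bigr => e _.
  by rewrite mulr_sumr.
rewrite exchange_big /= -sum1_card natr_sum mulr_sumr; apply: eq_bigr => e eK.
rewrite exchange_big /= (bigD1 e) //= sample_covariance ?KM // eqxx big1.
  by rewrite addr0 mulr1.
move=> f /andP[fK /negbTE nfe].
by rewrite sample_covariance ?KM // eq_sym nfe.
Qed.

Lemma sample_probE M P :
  sample_prob p M P = \sum_(J in powerset M) sample_weight M J * (P J)%:R.
Proof.
rewrite /sample_prob big_mkcondr /=; apply: eq_bigr => J _.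
by case: (P J); rewrite ?mulr1 ?mulr0.
Qed.

Hypothesis p01 : 0 <= p <= 1.

Lemma sample_weight_ge0 M J : 0 <= sample_weight M J.
Proof.
case/andP: p01 => p0 p1.
by apply: prodr_ge0 => e _; case: ifP; rewrite ?subr_ge0.
Qed.

Lemma sample_probT M : sample_prob p M predT = 1.
Proof.
rewrite /sample_prob; under eq_bigl do rewrite andbT.
by rewrite prod_add_powerset big1 // => e _; rewrite addrC subrK.
Qed.

Lemma sample_prob_mono M P Q :
  (forall J : {set T}, J \subset M -> P J -> Q J) -> sample_prob p M P <= sample_prob p M Q.
Proof.
move=> PQ; rewrite !sample_probE; apply: ler_sum => J; rewrite powersetE => JM.
apply: ler_wpM2l; first exact: sample_weight_ge0.
by rewrite ler_nat; case: (boolP (P J)) => // /(PQ _ JM) ->.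
Qed.

Lemma sample_prob_le1 M P : sample_prob p M P <= 1.
Proof. by rewrite -(sample_probT M); apply: sample_prob_mono. Qed.

Lemma sample_prob_union M P Q :
  sample_prob p M (predU P Q) <= sample_prob p M P + sample_prob p M Q.
Proof.
rewrite !sample_probE -big_split /=; apply: ler_sum => J _.
rewrite -mulrDr; apply: ler_wpM2l; first exact: sample_weight_ge0.
by rewrite -natrD ler_nat; case: (P J); case: (Q J).
Qed.

Lemma sample_probC M P : sample_prob p M P = 1 - sample_prob p M (predC P).
Proof.
rewrite -(sample_probT M) !sample_probE -sumrB; apply: eq_bigr => J _.
by rewrite -mulrBr /=; case: (P J); rewrite ?subr0 ?subrr.
Qed.

Lemma sample_chebyshev M K (a : R) : K \subset M -> 0 < a ->
  sample_prob p M (fun J => a < `|#|J :&: K|%:R - p * #|K|%:R|)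
  <= #|K|%:R / a ^+ 2.
Proof.
move=> KM a0; rewrite ler_pdivlMr ?exprn_gt0 //.
apply: (@le_trans _ _ (p * (1 - p) * #|K|%:R)); last first.
  by rewrite ler_piMl ?ler0n //; case/andP: p01 => *; nra.
rewrite -(sample_variance KM) sample_probE mulr_suml; apply: ler_sum => J _.
rewrite -mulrA; apply: ler_wpM2l; first exact: sample_weight_ge0.
case: ltP => [aJ | _]; last by rewrite mul0r sqr_ge0.
rewrite mul1r -[X in _ <= X]real_normK ?num_real //.
by rewrite lerXn2r ?nnegrE ?normr_ge0 ?ltW.
Qed.

End SamplingBounds.

(** * The bound for fixed N, and the limit *)

Lemma card_sampled_setI N (J : {set hard_edge N}) (I : {set 'I_N}) :
  #|J :&: [set matched_edge i | i in I]| = #|sampled J :&: I|.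
Proof.
rewrite -(card_imset (sampled J :&: I) (@matched_edge_inj N)); apply: eq_card => e.
rewrite inE; apply/andP/imsetP => [[eJ /imsetP[i iI E]] | [i + ->]].
  by exists i => //; rewrite !inE iI -E eJ.
by rewrite !inE => /andP[iJ iI]; split => //; apply: imset_f.
Qed.

Lemma card_ord_itv N a b : (b <= N)%N -> #|[set x : 'I_N | a <= x < b]%N| = (b - a)%N.
Proof.
move=> bN; rewrite -sum1_card -[RHS]muln1 -sum_nat_const_nat.
rewrite (big_nat_widen _ _ N) // (big_nat_widenl _ 0) // big_mkord.
by apply: eq_bigl => x; rewrite inE andbC.
Qed.

(** Here n is N, D is d, L is [lo], c counts the sampled indices of the middle interval and q is the
    number of paths. After multiplication by D the main terms agree, since (D - p) / (D + p) = 1 - 2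
    w. The errors 2 delta n w + 2 p + delta n + 2 D are at most 7 delta n D, within the 8 delta n D
    that [4 * delta] provides. *)
Lemma FAP_card_bound_arith (R : realFieldType) (n D p delta L q c mu : R) :
  0 < n -> 1 <= D -> 0 < p -> p <= 1 -> 0 < delta -> 1 <= delta * n ->
  n * (p - delta) / (D + p) <= L + 1 ->
  c <= p * (n - 2 * L) + delta * n -> (q - 2) * D <= c -> 2 * n <= mu ->
  q <= (((D + p)^-1 - (2 * D)^-1) * p + 4 * delta) * mu.
Proof.
move=> n0 D1 p0 p1 d0 dn1 L_ge c_le q_le mu_ge.
have D0 : 0 < D by lra.
have Dp0 : 0 < D + p by lra.
have coefE : ((D + p)^-1 - (2 * D)^-1) * p = p * (D - p) / (D + p) / (2 * D).
  by field; rewrite !gt_eqF //.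
have coef0 : 0 <= ((D + p)^-1 - (2 * D)^-1) * p + 4 * delta.
  rewrite coefE addr_ge0 //; last lra.
  by rewrite !mulr_ge0 ?invr_ge0 //; lra.
apply: le_trans (ler_wpM2l coef0 mu_ge).
rewrite -(ler_pM2r D0) coefE.
pose w := p / (D + p).
have w1 : w <= 1 by rewrite ler_pdivrMr //; lra.
have -> : (p * (D - p) / (D + p) / (2 * D) + 4 * delta) * (2 * n) * D =
          p * n - 2 * w * p * n + 8 * (delta * n) * D.
  by rewrite /w; field; rewrite !gt_eqF.
have pL : p * n * w - delta * n * w <= p * L + p.
  have -> : p * n * w - delta * n * w = p * (n * (p - delta) / (D + p)).
    by rewrite /w; field; rewrite !gt_eqF.
  by rewrite -[X in _ <= _ + X]mulr1 -mulrDr ler_wpM2l // ltW.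
have dnw : delta * n * w <= delta * n by rewrite ler_piMr //; lra.
have dnD : delta * n <= delta * n * D by rewrite ler_peMr //; lra.
have DdnD : D <= delta * n * D by rewrite ler_peMl //; lra.
lra.
Qed.

Lemma FAP_hard_prob (R : realType) N d (p delta : R) (s : seq (hard_edge N)) :
  (0 < N)%N -> hard_stream s -> (0 < d)%N -> 0 < p -> p <= 1 -> 0 < delta ->
  1 <= delta * N%:R ->
  1 - 3 / (delta ^+ 2 * N%:R) <=
  sample_prob p (hard_M N)
      (fun M' : {set hard_edge N} =>
         [forall Q : {set path3 (side N) (side N)},
            FAP_output (hard_G N) s (hard_M N) d M' Q ==>
            [&& vertex_disjoint Q,
                [forall q in Q, augmenting_path (hard_G N) (hard_M N) q] &
                #|Q|%:R <= (((d%:R + p)^-1 - (2 * d%:R)^-1) * p + 4 * delta)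
                           * (mu (hard_G N))%:R]]).
Proof.
move=> N0 s_hard d0 p0 p1 delta0 delta1.
have p01 : 0 <= p <= 1 by rewrite ltW.
set n : R := N%:R; set D : R := d%:R.
have n0 : 0 < n by rewrite ltr0n.
have D1 : 1 <= D by rewrite ler1n.
have Dp0 : 0 < D + p by lra.
(* Solves d lo <= p (N - lo) - delta N, whose right side is the guaranteed number of sampled indices
   in an interval of length N - lo. A negative quotient truncates to 0, for which the filling
   conditions are trivial. *)
pose lo := Num.truncn (n * (p - delta) / (D + p)).
pose L : R := lo%:R.
have L_ge : n * (p - delta) / (D + p) <= L + 1.
  by rewrite /L natr1 ltW // truncnS_gt.
have L_le : lo = 0%N \/ L * (D + p) <= n * (p - delta).
  have [x0|x0] := leP 0 (n * (p - delta) / (D + p)).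
    by right; rewrite -ler_pdivlMr // /L truncn_le.
  by left; apply/eqP; rewrite -leqn0 leqNgt truncn_gt_nat -ltNge (lt_trans x0).
have lo2 : (lo + lo <= N)%N.
  case: L_le => [-> // | L_le]; rewrite -(ler_nat R) natrD -/L -/n.
  rewrite -(ler_pM2r Dp0).
  have : 0 <= n * (D - p) by rewrite mulr_ge0 //; lra.
  have : 0 <= n * delta by rewrite mulr_ge0 //; lra.
  by move: L_le; rewrite /=; lra.
(* [I1] and [I2] need lower bounds, to fill [lo] bins on either side, and [I3] an upper bound. Three
   failures of probability at most 1 / (delta^2 N) each explain the 3 in the statement. *)
pose I1 := [set x : 'I_N | lo <= x < N]%N.
pose I2 := [set x : 'I_N | 0 <= x < N - lo]%N.
pose I3 := [set x : 'I_N | lo <= x < N - lo]%N.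
have cI1 : #|I1|%:R = n - L by rewrite card_ord_itv // natrB //; lia.
have cI2 : #|I2|%:R = n - L by rewrite card_ord_itv ?subn0 ?natrB //; lia.
have cI3 : #|I3|%:R = n - 2 * L.
  by rewrite card_ord_itv ?natrB -/n -/L; [lra | lia..].
pose bad (I : {set 'I_N}) : pred {set hard_edge N} := fun J =>
  delta * n < `|#|J :&: [set matched_edge i | i in I]|%:R
               - p * #|[set matched_edge i | i in I]|%:R|.
have bad_prob I : sample_prob p (hard_M N) (bad I) <= 1 / (delta ^+ 2 * n).
  have IM : [set matched_edge i | i in I] \subset hard_M N.
    by apply/subsetP => e /imsetP[i _ ->]; apply/hard_M_P; exists i.
  apply: (le_trans (sample_chebyshev p01 IM (mulr_gt0 delta0 n0))).
  rewrite card_imset; last exact: matched_edge_inj.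
  have -> : 1 / (delta ^+ 2 * n) = n / (delta * n) ^+ 2.
    by field; rewrite !gt_eqF.
  rewrite ler_wpM2r ?invr_ge0 ?sqr_ge0 // ler_nat.
  by rewrite -[X in (_ <= X)%N]card_ord max_card.
rewrite sample_probC // lerD2l lerN2.
apply: (@le_trans _ _ (sample_prob p (hard_M N) (predU (bad I1) (predU (bad I2) (bad I3))))).
  apply: sample_prob_mono => // J JM; apply: contraR.
  rewrite /= !negb_or -!leNgt !card_sampled_setI !card_imset; last 3 first.
  - exact: matched_edge_inj.
  - exact: matched_edge_inj.
  - exact: matched_edge_inj.
  rewrite cI1 cI2 cI3 !ler_distl => /and3P[/andP[c1 _] /andP[c2 _] /andP[_ c3]].
  apply/forallP => Q; apply/implyP => /and3P[QP Qd _]; rewrite Qd /=.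
  apply/andP; split.
    apply/forall_inP => q /(subsetP QP).
    exact: FAP_path_augmenting.
  have full (c : nat) : p * (n - L) - delta * n <= c%:R -> (d * lo <= c)%N.
    move=> cge; case: L_le => [-> | L_le]; first by rewrite muln0.
    by rewrite -(ler_nat R) natrM -/L -/D; lra.
  have /= Qc := @FAP_output_card N d s J d0 s_hard JM lo Q _ _ QP Qd.
  apply: (@FAP_card_bound_arith R n D p delta L #|Q|%:R #|sampled J :&: I3|%:R) => //.
  + have {}Qc : (#|Q| <= #|sampled J :&: I3| %/ d + 2)%N.
      have -> : sampled J :&: I3 = [set x in sampled J | lo <= x < N - lo]%N.
        by apply/setP => x; rewrite !inE.
      apply: Qc; apply: full; [move: c1 | move: c2]; congr (_ <= _%:R).
        by apply: eq_card => x; rewrite !inE ltn_ord andbT.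
      by apply: eq_card => x; rewrite !inE.
    apply: (@le_trans _ _ ((#|sampled J :&: I3| %/ d)%N%:R * D)).
      by rewrite ler_wpM2r ?ler0n // lerBlDr -natrD ler_nat.
    by rewrite -natrM ler_nat leq_trunc_div.
  + by rewrite -natrM ler_nat hard_mu_ge.
apply: (le_trans (sample_prob_union p01 _ _ _)).
have -> : 3 / (delta ^+ 2 * n) =
  1 / (delta ^+ 2 * n) + (1 / (delta ^+ 2 * n) + 1 / (delta ^+ 2 * n)) by lra.
apply: lerD => //; apply: (le_trans (sample_prob_union p01 _ _ _)); exact: lerD.
Qed.

Theorem theorem6 (R : realType) (d : nat) (p : R) :
  (1 <= d)%N -> 0 < p -> p <= 1 ->
  exists2 eps : nat -> R, eps N @[N --> \oo] --> (0 : R) &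
  forall s : forall N : nat, seq (hard_edge N),
    (forall N : nat, (0 < N)%N -> hard_stream (s N)) ->
    sample_prob p (hard_M N)
      (fun M' : {set hard_edge N} =>
         [forall Q : {set path3 (side N) (side N)},
            FAP_output (hard_G N) (s N) (hard_M N) d M' Q ==>
            [&& vertex_disjoint Q,
                [forall q in Q, augmenting_path (hard_G N) (hard_M N) q] &
                #|Q|%:R <= (((d%:R + p)^-1 - (2 * d%:R)^-1) * p + eps N)
                           * (mu (hard_G N))%:R]])
      @[N --> \oo] --> (1 : R).
Proof.
move=> d0 p0 p1.
(* With N^(-1/4) the error tends to 0, while delta N >= 1 for N > 0, and delta^2 N = N^(1/2) makes
   the failure probability 3 / (delta^2 N) = 3 delta^2 vanish. *)
pose delta (N : nat) : R := (Num.sqrt (Num.sqrt N%:R))^-1.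
have delta_gt0 N : (0 < N)%N -> 0 < delta N.
  by move=> N0; rewrite invr_gt0 !sqrtr_gt0 ltr0n.
have delta4 N : (0 < N)%N -> delta N ^+ 2 * N%:R = (delta N ^+ 2)^-1.
  move=> N0; rewrite /delta exprVn sqr_sqrtr ?sqrtr_ge0 // invrK.
  have r0 : Num.sqrt (N%:R : R) != 0 by rewrite gt_eqF // sqrtr_gt0 ltr0n.
  by rewrite -[X in _ * X]sqr_sqrtr ?ler0n // expr2 mulKf.
have delta_cvg0 : delta N @[N --> \oo] --> (0 : R).
  apply/cvgr0Pnorm_lt => e e0.
  near=> N.
  have Ne : e^-1 ^+ 4 < N%:R by near: N; exact: nbhs_infty_gtr.
  have N0 : (0 < N)%N by rewrite -(ltr0n R) (le_lt_trans _ Ne) // exprn_ge0 // invr_ge0 ltW.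
  rewrite ger0_norm ?(ltW (delta_gt0 _ N0)) // invf_plt ?posrE ?sqrtr_gt0 ?ltr0n //.
  have -> : e^-1 = Num.sqrt (Num.sqrt (e^-1 ^+ 4)).
    have e'0 : 0 <= e^-1 by rewrite invr_ge0 ltW.
    rewrite -[4%N]/(2 * 2)%N exprM sqrtr_sqr ger0_norm ?exprn_ge0 //.
    by rewrite sqrtr_sqr ger0_norm.
  by rewrite !ltr_sqrt ?sqrtr_gt0 ?ltr0n.
(* The 4 comes from [FAP_card_bound_arith]; the witness is fixed before the streams, so the error is
   uniform over them. *)
exists (fun N => 4 * delta N).
  rewrite -[X in _ --> X](mulr0 4); apply: cvgM => //; exact: cvg_cst.
move=> s s_hard.
apply: (@squeeze_cvgr _ _ _ _ (fun N => 1 - 3 * delta N ^+ 2) (fun=> 1)).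
- near=> N.
  have N0 : (0 < N)%N by near: N; exact: nbhs_infty_gt.
  apply/andP; split; last by apply: sample_prob_le1; rewrite ltW.
  have dd := delta_gt0 _ N0.
  have := @FAP_hard_prob R N d p (delta N) (s N) N0 (s_hard _ N0) d0 p0 p1 dd.
  rewrite delta4 // invrK; apply.
  have r1 : delta N <= 1.
    have sqrt_ge1 (x : R) : 1 <= x -> 1 <= Num.sqrt x.
      by move=> x1; rewrite -{1}(@sqrtr1 R) ler_wsqrtr.
    by rewrite invf_le1 ?sqrtr_gt0 ?ltr0n // !sqrt_ge1 // ler1n.
  have -> : delta N * N%:R = (delta N)^-1 * (delta N ^+ 2 * N%:R).
    by field; rewrite gt_eqF.
  by rewrite delta4 // -invfM -exprS invf_ge1 ?exprn_gt0 // exprn_ile1 // ltW.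
- rewrite -[X in _ --> X](subr0 1) -[X in _ - X](mulr0 3) -[X in 3 * X](mulr0 0).
  apply: cvgB; first exact: cvg_cst.
  apply: cvgM; first exact: cvg_cst.
  by apply: cvgM.
- exact: cvg_cst.
Unshelve. all: by end_near.
Qed.
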